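(* Let $p$ and $q$ be prime numbers. Suppose that $K_0,\ldots,K_{p-1}$ and $L_0,\ldots,L_{p-1}$ are unitary $q\times q$ complex matrices such that $K_m^\dagger L_n$ is a complex Hadamard matrix for all $m,n=0,\ldots,p-1$. Let $M$ be a complex Hadamard matrix of order $p$ whose $(i,j)$th element is $\alpha_{ij}/\sqrt{p}$, with $|\alpha_{ij}|=1$, for $i,j=1,\ldots,p$. Then the $pq\times pq$ block matrix $$H_{pq}=\frac{1}{\sqrt{p}}\begin{pmatrix} \alpha_{11}K_0^\dagger L_0 & \alpha_{12}K_0^\dagger L_1 & \ldots & \alpha_{1p}K_0^\dagger L_{p-1}\\ \alpha_{21}K_1^{\dagger}L_0 & \alpha_{22}K_1^{\dagger}L_1 & \ldots & \alpha_{2p}K_1^{\dagger}L_{p-1}\\ \vdots & \vdots & & \vdots\\ \alpha_{p1}K_{p-1}^{\dagger}L_0 & \alpha_{p2}K_{p-1}^{\dagger}L_1 & \ldots & \alpha_{pp}K_{p-1}^{\dagger}L_{p-1}\end{pmatrix},$$ whose $(i,j)$th block ($1\le i,j\le p$) is $\frac{1}{\sqrt p}\,\alpha_{ij}K_{i-1}^\dagger L_{j-1}$, is a complex Hadamard matrix of order $pq$.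
   Context: A complex Hadamard matrix of order $d$ is a $d\times d$ complex matrix $H$ that is unitary ($HH^\dagger=I$) and all of whose elements have equal modulus; consequently each element has modulus $1/\sqrt{d}$. Here $\dagger$ denotes the conjugate transpose. *)

(* Defs.v *)
From HB Require Import structures.
From mathcomp Require Import all_boot all_order all_algebra.
From mathcomp Require Import reals complex.
Set Implicit Arguments.
Unset Strict Implicit.
Unset Printing Implicit Defensive.
Import Order.TTheory GRing.Theory Num.Theory.
Local Open Scope ring_scope.
Local Open Scope sesquilinear_scope.

Definition complex_hadamard (C : numClosedFieldType) (d : nat)
    (H : 'M[C]_d) : Prop :=
  H \is unitarymx /\ forall i j k l : 'I_d, `|H i j| = `|H k l|.

Lemma sum_const_ord (p q : nat) : (\sum_(i < p) q = p * q)%N.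
Proof. by rewrite sum_nat_const card_ord. Qed.

(* A block matrix built by [\mxblock] has size [\sum_(i < p) q], which is only
   propositionally equal to [p * q]; the cast relabels the indices and leaves
   their numerical values unchanged. Blocks are numbered from 0, so block
   (i, j) corresponds to the usual (i + 1, j + 1). *)
Definition hadamard_block (C : numClosedFieldType) (p q : nat)
    (alpha : 'M[C]_p) (K L : 'I_p -> 'M[C]_q) : 'M[C]_(p * q) :=
  castmx (sum_const_ord p q, sum_const_ord p q)
    ((sqrtC p%:R)^-1 *:
       \mxblock_(i < p, j < p) (alpha i j *: ((K i)^t* *m L j))).

(* Main.v *)
(** Scaling the blocks by [1 / sqrt p] gives the matrix with blocks
    [M_ij K_i^dagger L_j]. In its product with its conjugate transpose each
    [L_k L_k^dagger] cancels, so block [(i, j)] is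
    [(M M^dagger)_ij K_i^dagger K_j], the identity if [i = j] and zero
    otherwise. The moduli of the entries agree across blocks because every
    Hadamard matrix of order [q] has entries of modulus [1 / sqrt q]. *)

Require Import Defs.
From HB Require Import structures.
From mathcomp Require Import all_boot all_order all_algebra.
From mathcomp Require Import reals complex.
Set Implicit Arguments.
Unset Strict Implicit.
Unset Printing Implicit Defensive.
Import Order.TTheory GRing.Theory Num.Theory.
Local Open Scope ring_scope.
Local Open Scope sesquilinear_scope.

(** Each diagonal entry of [H H^dagger = I] is a sum of [d] equal squared moduli. *)
Lemma complex_hadamard_norm (C : numClosedFieldType) (d : nat) (H : 'M[C]_d)
    (i j : 'I_d) :
  complex_hadamard H -> `|H i j| = (sqrtC d%:R)^-1.
Proof.
case=> /unitarymxP HU Hnorm.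
have d_gt0 : (0 < d)%N by apply: leq_ltn_trans (ltn_ord i).
have : d%:R * `|H i j| ^+ 2 = 1.
  have /matrixP/(_ i i) := HU; rewrite !mxE eqxx.
  under eq_bigr => k _ do rewrite !mxE -normCK (Hnorm i k i j).
  by rewrite sumr_const card_ord mulr_natl.
move=> /(congr1 (fun x => sqrtC x)); rewrite sqrtC1.
rewrite rootCMl ?ler0n // sqrCK // => /(canRL (mulKf _)) ->.
  by rewrite mulr1.
by rewrite sqrtC_eq0 pnatr_eq0 -lt0n.
Qed.

Lemma castmx_complex_hadamard (C : numClosedFieldType) (m n : nat) (e : m = n)
    (H : 'M[C]_m) :
  complex_hadamard H -> complex_hadamard (castmx (e, e) H).
Proof. by case: n / e; rewrite castmx_id. Qed.

Lemma mxblock_scale_unitary (C : numClosedFieldType) (p q : nat) (M : 'M[C]_p)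
    (K L : 'I_p -> 'M[C]_q) :
  M \is unitarymx -> (forall i, K i \is unitarymx) ->
  (forall i, L i \is unitarymx) ->
  \mxblock_(i < p, j < p) (M i j *: ((K i)^t* *m L j)) \is unitarymx.
Proof.
move=> /unitarymxP MU KU LU; apply/unitarymxP.
have block_trC i j :
    (M i j *: ((K i)^t* *m L j))^t* = (M i j)^* *: ((L j)^t* *m K i).
  by rewrite linearZ /= map_mxZ trmx_mul map_mxM trmxCK.
rewrite tr_mxblock.
(* Transposition has already swapped the blocks; conjugation, being entrywise, now moves inside each
   of them. *)
have -> : (\mxblock_(i < p, j < p) (M j i *: ((K j)^t* *m L i))^T) ^ Num.conj
    = \mxblock_(i < p, j < p) ((M j i)^* *: ((L i)^t* *m K j)).
  by apply/matrixP => i j; rewrite 2!mxE [RHS]mxE -block_trC [RHS]mxE.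
(* The identity is read as a block-diagonal matrix, so that blocks can be compared. *)
rewrite mul_mxblock -mxdiagZ; apply: eq_mxblock => i j.
under eq_bigr => k _ do
  rewrite -scalemxAl -scalemxAr scalerA mulmxA mulmxtVK //.
rewrite -scaler_suml.
have -> : \sum_k M i k * (M j k)^* = (i == j)%:R.
  have /matrixP/(_ i j) := MU; rewrite !mxE => <-.
  by apply: eq_bigr => k _; rewrite !mxE.
case: (eqVneq i j) => [<-|_].
  (* Unitarity gives [K_i K_i^dagger = I]; for square matrices the product in the other order, which
     is the one needed, is also [I]. *)
  have /unitarymxP := KU i; move=> /mulmx1C ->.
  by rewrite conform_mx_id scale1r.
by rewrite scale0r.
Qed.

Theorem theorem3 (R : realType) (p q : nat) (hp : prime p) (hq : prime q)
    (K L : 'I_p -> 'M[R[i]]_q)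
    (hK : forall m : 'I_p, K m \is unitarymx)
    (hL : forall n : 'I_p, L n \is unitarymx)
    (hKL : forall m n : 'I_p, complex_hadamard ((K m)^t* *m L n))
    (M alpha : 'M[R[i]]_p)
    (hM : complex_hadamard M)
    (halpha : forall i j : 'I_p, `|alpha i j| = 1)
    (hMalpha : forall i j : 'I_p, M i j = alpha i j / sqrtC p%:R) :
  complex_hadamard (hadamard_block alpha K L).
Proof.
apply: castmx_complex_hadamard; split=> [|i j k l].
  have -> : (sqrtC p%:R)^-1 *:
        \mxblock_(i < p, j < p) (alpha i j *: ((K i)^t* *m L j))
      = \mxblock_(i < p, j < p) (M i j *: ((K i)^t* *m L j)).
    apply/matrixP => i j; rewrite mxE [in LHS]mxE [in RHS]mxE.
    by rewrite [in LHS]mxE [in RHS]mxE hMalpha mulrCA mulrA.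
  exact: mxblock_scale_unitary hM.1 hK hL.
(* The factor [1 / sqrt p] is common to all entries, so only the unscaled moduli matter. *)
suff norm_entry s t :
    `|(\mxblock_(i < p, j < p) (alpha i j *: ((K i)^t* *m L j))) s t|
    = (sqrtC q%:R)^-1.
  by rewrite mxE [in RHS]mxE !normrM !norm_entry.
by rewrite mxE mxE normrM halpha mul1r complex_hadamard_norm.
Qed.
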